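(* Let $\Gamma$ be a balanced, weakly connected graph with nonnegative weights and at least two vertices. Then $$0\leq 1-\sqrt{1-h^2(U(\Gamma))}\leq \min_{i\neq 0}\Re(\lambda_i(\Delta(\Gamma)))$$ and $$\max_i\Re(\lambda_i(\Delta(\Gamma)))\leq 1+\sqrt{1-(1-\overline{h}(U(\Gamma)))^2}\leq 2,$$ where $h(U(\Gamma))$ and $\overline{h}(U(\Gamma))$ are the Cheeger constant and the dual Cheeger constant of the underlying graph $U(\Gamma)$.
   Context: A graph $\Gamma=(V,E,w)$ is a finite weighted directed graph, loops allowed, without multiple edges; $w_{ij}$ is the weight of the directed edge from $j$ to $i$, with $w_{ij}=0$ if and only if there is no such edge. $d_i^{\mathrm{in}}=\sum_j w_{ij}$, $d_i^{\mathrm{out}}=\sum_j w_{ji}$; $\Gamma$ is balanced if $d_i^{\mathrm{in}}=d_i^{\mathrm{out}}$ for all $i\in V$. $\Gamma$ is weakly connected if replacing all directed edges by undirected ones gives a connected graph. The normalized Laplace operator on complex valued functions on $V$ is $\Delta v(i)=v(i)-\frac{1}{d_i^{\mathrm{in}}}\sum_j w_{ij}v(j)$ if $d_i^{\mathrm{in}}\neq 0$ and $\Delta v(i)=0$ otherwise. Its eigenvalues (with algebraic multiplicity) are $\lambda_0,\dots,\lambda_{n-1}$, $n=|V|$, where $\lambda_0=0$ is the eigenvalue corresponding to the constant function. The underlying graph $U(\Gamma)$ is the undirected graph on $V$ with symmetric weights $w_{ij}+w_{ji}$ for all $i,j\in V$ (so a loop gets twice its weight). For an undirected graph with nonnegative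 symmetric weights $w_{ij}$ and degrees $d_i=\sum_j w_{ij}$, let $\mathrm{vol}(W)=\sum_{i\in W}d_i$ and $|E(W,W')|=\sum_{k\in W,\,l\in W'}w_{kl}$ for $W,W'\subseteq V$. The Cheeger constant is $h=\min\frac{|E(W,\overline W)|}{\min\{\mathrm{vol}(W),\mathrm{vol}(\overline W)\}}$, the minimum over all $W\subsetneq V$ with $W$ and $\overline W=V\setminus W$ both nonempty. The dual Cheeger constant is $\overline h=\max\frac{2|E(V_1,V_2)|}{\mathrm{vol}(V_1)+\mathrm{vol}(V_2)}$, the maximum over all disjoint nonempty $V_1,V_2\subseteq V$ (with $V_3=V\setminus(V_1\cup V_2)$ possibly empty). *)

(* Defs.v *)
From HB Require Import structures.
From mathcomp Require Import all_boot all_order all_algebra.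
From mathcomp Require Import reals.
From mathcomp Require Import complex.

Set Implicit Arguments.
Unset Strict Implicit.
Unset Printing Implicit Defensive.

Import Order.TTheory GRing.Theory Num.Theory.
Local Open Scope ring_scope.
Local Open Scope complex_scope.

(* Minimum and maximum of a nonempty finite list of reals; the head of the
   list only serves as starting value, and the junk value on [::] is 0. *)
Definition min_seq (R : realType) (s : seq R) : R :=
  \big[Num.min/head 0 s]_(x <- s) x.

Definition max_seq (R : realType) (s : seq R) : R :=
  \big[Num.max/head 0 s]_(x <- s) x.

Lemma min_seqP (R : realType) (s : seq R) : s != [::] ->
  min_seq s \in s /\ (forall x, x \in s -> min_seq s <= x).
Proof.
case: s => // a s _; rewrite /min_seq /=; split; last first.
  elim: (a :: s) => // b r IHr x; rewrite inE big_cons ge_min.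
  by case/predU1P => [->|/IHr ->]; rewrite ?lexx ?orbT.
rewrite big_seq; apply: (big_ind (fun y => y \in a :: s)).
- exact: mem_head.
- by move=> x y xs ys; case: (leP x y).
- by [].
Qed.

Lemma max_seqP (R : realType) (s : seq R) : s != [::] ->
  max_seq s \in s /\ (forall x, x \in s -> x <= max_seq s).
Proof.
case: s => // a s _; rewrite /max_seq /=; split; last first.
  elim: (a :: s) => // b r IHr x; rewrite inE big_cons le_max.
  by case/predU1P => [->|/IHr ->]; rewrite ?lexx ?orbT.
rewrite big_seq; apply: (big_ind (fun y => y \in a :: s)).
- exact: mem_head.
- by move=> x y xs ys; case: (leP x y).
- by [].
Qed.

(* A weighted directed graph on the vertex set 'I_n is given by its weight
   matrix w : 'M[R]_n, where w i j is the weight of the edge from j to i and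
   w i j = 0 means that there is no such edge. *)

Definition deg_in (R : realType) (n : nat) (w : 'M[R]_n) (i : 'I_n) : R :=
  \sum_j w i j.

Definition deg_out (R : realType) (n : nat) (w : 'M[R]_n) (i : 'I_n) : R :=
  \sum_j w j i.

Definition balanced (R : realType) (n : nat) (w : 'M[R]_n) : Prop :=
  forall i, deg_in w i = deg_out w i.

Definition adjacent (R : realType) (n : nat) (w : 'M[R]_n) : rel 'I_n :=
  [rel i j | (w i j != 0) || (w j i != 0)].

Definition weakly_connected (R : realType) (n : nat) (w : 'M[R]_n) : Prop :=
  forall i j, connect (adjacent w) i j.

Definition laplacian (R : realType) (n : nat) (w : 'M[R]_n)
    (v : 'cV[R[i]]_n) : 'cV[R[i]]_n :=
  \col_i (if deg_in w i != 0
          then v i 0 - ((deg_in w i)^-1)%:C * \sum_j (w i j)%:C * v j 0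
          else 0).

(* Column j is the image of the indicator function of the vertex j. *)
Definition laplacian_mx (R : realType) (n : nat) (w : 'M[R]_n) : 'M[R[i]]_n :=
  \matrix_(i, j) laplacian w (delta_mx j 0) i 0.

Lemma laplacian_mxE (R : realType) (n : nat) (w : 'M[R]_n) (v : 'cV[R[i]]_n) :
  laplacian_mx w *m v = laplacian w v.
Proof.
apply/colP => i; rewrite !mxE.
case: ifPn => [di|/negbTE di]; last first.
  by rewrite big1 // => j _; rewrite !mxE di mul0r.
under eq_bigr => j _ do rewrite !mxE di eqxx andbT mulrBl.
rewrite big_split /= (bigD1 i) //= eqxx mul1r big1 ?addr0; last first.
  by move=> j ji; rewrite eq_sym (negbTE ji) mul0r.
rewrite sumrN mulr_sumr; congr (_ - _); apply: eq_bigr => j _.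
rewrite (bigD1 j) //= mxE !eqxx mulr1 big1 ?addr0 ?mulrA // => k kj.
by rewrite mxE (negbTE kj) mulr0.
Qed.

(* The eigenvalues of A, listed with algebraic multiplicity. *)
Definition eigenvalues (R : realType) (n : nat) (A : 'M[R[i]]_n) : seq R[i] :=
  sval (closed_field_poly_normal (char_poly A)).

Lemma eigenvaluesP (R : realType) (n : nat) (A : 'M[R[i]]_n) :
  char_poly A = \prod_(z <- eigenvalues A) ('X - z%:P).
Proof.
rewrite /eigenvalues; case: closed_field_poly_normal => s /= {1}->.
by rewrite (monicP (char_poly_monic A)) scale1r.
Qed.

Lemma size_eigenvalues (R : realType) (n : nat) (A : 'M[R[i]]_n) :
  size (eigenvalues A) = n.
Proof.
by have := size_char_poly A; rewrite eigenvaluesP size_prod_XsubC => -[].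
Qed.

Lemma laplacian_const (R : realType) (n : nat) (w : 'M[R]_n) (c : R[i]) :
  laplacian w (const_mx c) = 0.
Proof.
apply/colP => i; rewrite !mxE; case: ifPn => // di.
under eq_bigr => j _ do rewrite mxE.
rewrite -mulr_suml -rmorph_sum /= -/(deg_in w i) mulrA -rmorphM /= mulVf //.
by rewrite mul1r subrr.
Qed.

Lemma eigenvalues_laplacian0 (R : realType) (n : nat) (w : 'M[R]_n) :
  (0 < n)%N -> 0 \in eigenvalues (laplacian_mx w).
Proof.
case: n w => // n w _; rewrite -root_prod_XsubC -eigenvaluesP.
rewrite -eigenvalue_root_char; apply: contraT => /negPn/eqP ker0.
have /(mulKmx)/(_ (const_mx 1 : 'cV_n.+1)) : laplacian_mx w \in unitmx.
  rewrite -row_free_unit -kermx_eq0; move: ker0.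
  by rewrite /eigenspace raddf0 subr0 => ->.
rewrite laplacian_mxE laplacian_const mulmx0 => /matrixP/(_ 0 0).
by rewrite !mxE => /eqP; rewrite eq_sym oner_eq0.
Qed.

(* The eigenvalues lambda_i with i <> 0: exactly one occurrence of the
   eigenvalue lambda_0 = 0 of the constant function is discarded. *)
Definition nonzero_index_eigenvalues (R : realType) (n : nat) (w : 'M[R]_n) :
    seq R[i] :=
  rem 0 (eigenvalues (laplacian_mx w)).

Definition underlying (R : realType) (n : nat) (w : 'M[R]_n) : 'M[R]_n :=
  \matrix_(i, j) (w i j + w j i).

(* In the following definitions w is the weight matrix of an undirected graph,
   hence symmetric, and the degree of a vertex is [deg_in w]. *)

Definition vol (R : realType) (n : nat) (w : 'M[R]_n) (W : {set 'I_n}) : R :=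
  \sum_(i in W) deg_in w i.

Definition cut (R : realType) (n : nat) (w : 'M[R]_n) (W W' : {set 'I_n}) : R :=
  \sum_(k in W) \sum_(l in W') w k l.

Definition cheeger (R : realType) (n : nat) (w : 'M[R]_n) : R :=
  min_seq [seq cut w W (~: W) / Num.min (vol w W) (vol w (~: W))
          | W in [set W : {set 'I_n} | (W != set0) && (~: W != set0)]].

Definition dual_cheeger (R : realType) (n : nat) (w : 'M[R]_n) : R :=
  max_seq [seq 2 * cut w P.1 P.2 / (vol w P.1 + vol w P.2)
          | P in [set P : {set 'I_n} * {set 'I_n} |
                   [&& P.1 != set0, P.2 != set0 & [disjoint P.1 & P.2]]]].

(* Main.v *)
Require Import Defs.
From HB Require Import structures.
From mathcomp Require Import all_boot all_order all_algebra.
From mathcomp Require Import reals.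
From mathcomp Require Import complex.
From mathcomp Require Import ring lra.

Set Implicit Arguments.
Unset Strict Implicit.
Unset Printing Implicit Defensive.

Import Order.TTheory GRing.Theory Num.Theory.
Local Open Scope ring_scope.
Local Open Scope complex_scope.

(** Why the theorem holds. Let d be the degree of the balanced graph and U its
    underlying graph. If v is an eigenvector for the eigenvalue
    z, then taking the real part of the weighted scalar product of v with its
    image under the Laplacian symmetrizes the weights, and balance makes the
    degrees of U equal to 2 * d. So Re z is the Rayleigh quotient of the real
    and imaginary parts of v for the undirected graph U ([rayleigh_quotient]).
    Balance also makes the degree vector a left null vector, so that an
    eigenvalue other than that of the constants has an eigenvector whose
    weighted mean is zero; since multiplicities count, this is proved by
    deflating the characteristic polynomial ([eigenvector_orthogonal],
    [laplacian_eigenvector]). It remains to bound Rayleigh quotients on U.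

    Both bounds are cases of one argument ([cheeger_energy]). Let k be the
    Cheeger constant with the edge term f i - f j, or one minus the dual Cheeger
    constant with the edge term f i + f j. Let N be the weighted square norm of
    f. The signed squares p = f * `|f| decompose into layers, each of which is a
    pair of disjoint vertex sets, positive and negative; the definition of the
    Cheeger constant, respectively of its dual, bounds the variation of every
    layer from below by k times its volume, hence the variation of p by k * N
    ([coarea]). On the other hand, that variation is bounded by Cauchy-Schwarz
    in terms of a quantity Q which is at most the energy: its square is at most
    Q * (2 * N - Q). Therefore (N - Q) ^+ 2 <= (1 - k ^+ 2) * N ^+ 2, that is
    Q >= (1 - Num.sqrt (1 - k ^+ 2)) * N.

    For the Cheeger constant the layers must have at most half of the total
    volume, and f is first shifted by a median; having mean zero, it does not
    lose norm in the shift ([cheeger_inequality]). For the dual constant, the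
    lower bound on the signless energy is turned into an upper bound on the
    Dirichlet energy by [energy_complement]. *)

(** * Elementary inequalities *)

(** Removing from x and y their lowest layer of height m splits off the
    contribution of the two signs: the remainders and the layers pull in the
    same direction. *)
Lemma abs_sub_layer (R : realDomainType) (b : bool) (m x y : R) : 0 <= m ->
    (x != 0 -> m <= `|x|) -> (y != 0 -> m <= `|y|) ->
  `|x + (-1) ^+ b * y| =
  `|(x - m * Num.sg x) + (-1) ^+ b * (y - m * Num.sg y)|
    + m * `|Num.sg x + (-1) ^+ b * Num.sg y|.
Proof.
move=> m0 mx my.
have -> : m * `|Num.sg x + (-1) ^+ b * Num.sg y| =
    `|m * (Num.sg x + (-1) ^+ b * Num.sg y)| by rewrite normrM (ger0_norm m0).
set a := (x - _ + _); set c := m * (_ + _).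
have -> : x + (-1) ^+ b * y = a + c by rewrite /a /c; ring.
(* Equality in the triangle inequality: a and c never have opposite signs. *)
suff /orP[/andP[a0 c0]|/andP[a0 c0]] :
    ((0 <= a) && (0 <= c)) || ((a <= 0) && (c <= 0)).
- by rewrite (ger0_norm a0) (ger0_norm c0) ger0_norm // addr_ge0.
- rewrite (ler0_norm a0) (ler0_norm c0) ler0_norm ?opprD //.
  by rewrite -oppr_ge0 opprD addr_ge0 ?oppr_ge0.
have sg_cases z : (z != 0 -> m <= `|z|) ->
    [\/ z = 0 /\ Num.sg z = 0, m <= z /\ Num.sg z = 1
      | m <= - z /\ Num.sg z = -1].
  have [-> _|z0 /(_ isT) mz|z0 /(_ isT) mz] := sgrP z.
  - by constructor 1.
  - by constructor 2.
  - by constructor 3.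
have := le_total 0 a.
rewrite /a /c {a c}; case: b; rewrite ?expr0 ?expr1;
  case: (sg_cases x mx) => -[hx ->]; case: (sg_cases y my) => -[hy ->];
  rewrite ?hx ?hy => /orP[] a0; apply/orP;
  try (by left; apply/andP; split; lra);
  try (by right; apply/andP; split; lra).
Qed.

Lemma discrete_CauchySchwarz (R : realDomainType) (I : finType)
    (t q r : I -> R) :
    (forall i, 0 <= q i) -> (forall i, 0 <= r i) ->
    (forall i, t i ^+ 2 <= q i * r i) ->
  (\sum_i t i) ^+ 2 <= (\sum_i q i) * (\sum_i r i).
Proof.
move=> q0 r0 tqr.
have dbl (a c : I -> R) : (\sum_i a i) * (\sum_i c i) =
    \sum_i \sum_j a i * c j.
  by rewrite mulr_suml; apply: eq_bigr => i _; rewrite mulr_sumr.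
suff : 2 * (\sum_i t i) ^+ 2 <=
    (\sum_i q i) * (\sum_i r i) + (\sum_i r i) * (\sum_i q i) by lra.
rewrite expr2 !dbl mulr_sumr -big_split /=.
apply: ler_sum => i _; rewrite mulr_sumr -big_split /=; apply: ler_sum => j _.
have A0 : 0 <= q i * r j by rewrite mulr_ge0.
have B0 : 0 <= r i * q j by rewrite mulr_ge0.
apply: le_trans (ler_norm _) _; rewrite -(ger0_norm (addr_ge0 A0 B0)).
rewrite -ler_sqr ?nnegrE //.
rewrite !real_normK ?num_real //.
have := ler_pM (sqr_ge0 (t i)) (sqr_ge0 (t j)) (tqr i) (tqr j).
have := sqr_ge0 (q i * r j - r i * q j).
nra.
Qed.

(** The number q is the part of the energy of an edge that is compatible with
    the signed squares x * `|x| and y * `|y|: together with its complement in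
    2 * (x ^+ 2 + y ^+ 2) it turns Cauchy-Schwarz into an equality on each edge.
    The full square (x + (-1) ^+ b * y) ^+ 2 would not do, when x and
    (-1) ^+ b * y have the same sign. *)
Lemma signed_square_split (R : realDomainType) (b : bool) (x y : R) :
  {q | [/\ 0 <= q, q <= (x + (-1) ^+ b * y) ^+ 2,
    q <= 2 * (x ^+ 2 + y ^+ 2) &
    (x * `|x| + (-1) ^+ b * (y * `|y|)) ^+ 2
      = q * (2 * (x ^+ 2 + y ^+ 2) - q)]}.
Proof.
have -> : (-1) ^+ b * (y * `|y|) = ((-1) ^+ b * y) * `|(-1) ^+ b * y|.
  by rewrite normrM normr_sign mul1r mulrA.
have -> : y ^+ 2 = ((-1) ^+ b * y) ^+ 2 by rewrite exprMn sqrr_sign mul1r.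
move: (_ * y) => {b}{}y.
(* Now the statement is about x + y; edges whose end values x and y have the
   same sign get the weaker value x ^+ 2 + y ^+ 2. *)
have [xy|xy] := leP 0 (x * y).
  exists (x ^+ 2 + y ^+ 2); split; [nra|lra|nra|].
  have sq (z : R) : `|z| ^+ 2 = z ^+ 2 by rewrite real_normK ?num_real.
  have e : `|x| * `|y| = x * y by rewrite -normrM ger0_norm.
  have sx := sq x; have sy := sq y.
  transitivity (x ^+ 2 * `|x| ^+ 2 + y ^+ 2 * `|y| ^+ 2
     + 2 * (x * y) * (`|x| * `|y|)); first by ring.
  by rewrite e sx sy; ring.
have := (sqr_ge0 (x + y), sqr_ge0 (x - y)) => -[s1 s2].
exists ((x + y) ^+ 2); split; [by []|by []|lra|].
have sq (z : R) : `|z| ^+ 2 = z ^+ 2 by rewrite real_normK ?num_real.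
have e : `|x| * `|y| = - (x * y) by rewrite -normrM ltr0_norm.
transitivity (x ^+ 2 * `|x| ^+ 2 + y ^+ 2 * `|y| ^+ 2
     + 2 * (x * y) * (`|x| * `|y|)); first by ring.
by rewrite e !sq; ring.
Qed.

(** Completing the square, the hypothesis reads
    (N - Q) ^+ 2 <= (1 - k ^+ 2) * N ^+ 2. *)
Lemma gap_le_of_sqr_le (R : rcfType) (k N Q : R) : 0 <= N ->
  k ^+ 2 * N ^+ 2 <= Q * (2 * N - Q) ->
  (1 - Num.sqrt (1 - k ^+ 2)) * N <= Q.
Proof.
move=> N0 kNQ.
suff : N - Q <= Num.sqrt (1 - k ^+ 2) * N by lra.
apply: le_trans (ler_norm _) _.
rewrite -sqrtr_sqr -{2}(ger0_norm N0) -(sqrtr_sqr N) mulrC -sqrtrM ?sqr_ge0 //.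
by apply: ler_wsqrtr; nra.
Qed.

(** * From isoperimetry to energy *)

Definition sqnorm (R : realType) (n : nat) (u : 'M[R]_n) (f : 'I_n -> R) : R :=
  \sum_i deg_in u i * f i ^+ 2.

(** For b = true this is the Dirichlet energy, for b = false its signless
    version, in which differences are replaced by sums. *)
Definition energy (R : realType) (n : nat) (u : 'M[R]_n) (b : bool)
    (f : 'I_n -> R) : R :=
  2^-1 * \sum_i \sum_j u i j * (f i + (-1) ^+ b * f j) ^+ 2.

Definition variation (R : realType) (n : nat) (u : 'M[R]_n) (b : bool)
    (p : 'I_n -> R) : R :=
  2^-1 * \sum_i \sum_j u i j * `|p i + (-1) ^+ b * p j|.

Definition level (R : realType) (n : nat) (P N : {set 'I_n}) (i : 'I_n) : R :=
  (i \in P)%:R - (i \in N)%:R.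

(** By symmetry, both ends of the edges contribute equally. *)
Lemma handshake (R : realType) (n : nat) (u : 'M[R]_n) (p : 'I_n -> R) :
    (forall i j, u i j = u j i) ->
  2^-1 * \sum_i \sum_j u i j * (p i + p j) = \sum_i deg_in u i * p i.
Proof.
move=> usym.
have E : \sum_i \sum_j u i j * p i = \sum_i deg_in u i * p i.
  by apply: eq_bigr => i _; rewrite mulr_suml.
have E' : \sum_i \sum_j u i j * p j = \sum_i deg_in u i * p i.
  rewrite exchange_big -E; apply: eq_bigr => i _; apply: eq_bigr => j _.
  by rewrite usym.
have -> : \sum_i \sum_j u i j * (p i + p j) =
    \sum_i \sum_j u i j * p i + \sum_i \sum_j u i j * p j.
  rewrite -big_split; apply: eq_bigr => i _; rewrite -big_split.
  by apply: eq_bigr => j _; rewrite mulrDr.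
by rewrite E E'; lra.
Qed.

Lemma energy_complement (R : realType) (n : nat) (u : 'M[R]_n) (f : 'I_n -> R) :
    (forall i j, u i j = u j i) ->
  energy u true f + energy u false f = 2 * sqnorm u f.
Proof.
move=> usym; rewrite /sqnorm -handshake // -mulrDr mulrCA; congr (_ * _).
rewrite mulr_sumr -big_split; apply: eq_bigr => i _.
rewrite mulr_sumr -big_split; apply: eq_bigr => j _.
by rewrite /= expr1 expr0; ring.
Qed.

Lemma disjoint_signs (R : realDomainType) (I : finType) (f : I -> R)
    (P N : {set I}) :
    (forall i, i \in P -> 0 < f i) -> (forall i, i \in N -> f i < 0) ->
  [disjoint P & N].
Proof.
move=> Pf Nf; rewrite disjoint_subset; apply/subsetP => i /Pf fi; rewrite inE.
by apply/negP => /Nf /(lt_trans fi); rewrite ltxx.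
Qed.

Lemma vol_level (R : realType) (n : nat) (u : 'M[R]_n) (P N : {set 'I_n}) :
    [disjoint P & N] ->
  \sum_i deg_in u i * `|level R P N i| = vol u P + vol u N.
Proof.
move=> dPN; rewrite /vol (big_mkcond (mem P)) (big_mkcond (mem N)).
rewrite -big_split /=.
apply: eq_bigr => i _; rewrite /level.
have := disjointFr dPN (x := i).
case: (i \in P) => [/(_ isT) ->|_]; last case: (i \in N);
  by rewrite /= ?(subr0, sub0r, normrN, normr1, normr0, mulr1, mulr0, addr0,
    add0r).
Qed.

(** Co-area inequality: p is a positive combination of the level functions of
    its layers, and both sides are additive along this decomposition, so that
    an isoperimetric inequality for pairs of sets of vertices where p is
    positive, respectively negative, extends to p. The induction removes the
    lowest layer, which shrinks the support. *)
Lemma coarea (R : realType) (n : nat) (u : 'M[R]_n) (b : bool) (k : R)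
    (p : 'I_n -> R) :
    (forall P N : {set 'I_n}, (forall i, i \in P -> 0 < p i) ->
       (forall i, i \in N -> p i < 0) ->
       k * (vol u P + vol u N) <= variation u b (level R P N)) ->
  k * (\sum_i deg_in u i * `|p i|) <= variation u b p.
Proof.
have [c] := ubnP #|[set i | p i != 0]|.
elim: c p => // c IH p; rewrite ltnS => pc kP.
have [p0|[i0]] := set_0Vmem [set i | p i != 0].
  have pz i : p i = 0.
    by apply/eqP/negbNE; have /setP/(_ i) := p0; rewrite !inE => ->.
  rewrite /variation big1 => [|i _]; last by rewrite pz normr0 mulr0.
  rewrite !mulr0 mulr_ge0 ?invr_ge0 //; apply: sumr_ge0 => i _.
  by rewrite big1 // => j _; rewrite !pz mulr0 addr0 normr0 mulr0.
rewrite inE => pi0.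
(* The lowest layer: m is the least nonzero value of |p|. *)
have [i1 pi1 pmin] :=
  @arg_minP _ R _ i0 (fun i => p i != 0) (fun i => `|p i|) pi0.
pose m := `|p i1|; pose p' i := p i - m * Num.sg (p i).
have m0 : 0 <= m by exact: normr_ge0.
have mp i : p i != 0 -> m <= `|p i| by exact: pmin.
pose P := [set i | 0 < p i]; pose N := [set i | p i < 0].
have sgE i : Num.sg (p i) = level R P N i.
  by rewrite /level !inE; case: (sgrP (p i)) => _; rewrite ?subr0 ?sub0r.
have dPN : [disjoint P & N] by apply: (@disjoint_signs _ _ p) => i; rewrite inE.
have p'_gt i : 0 < p' i -> 0 < p i.
  rewrite /p'; case: (sgrP (p i)) => // [->|h].
    by rewrite mulr0 subr0 ltxx.
  have := mp i (negbT (lt_eqF h)); rewrite ltr0_norm //; lra.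
have p'_lt i : p' i < 0 -> p i < 0.
  rewrite /p'; case: (sgrP (p i)) => // [->|h].
    by rewrite mulr0 subr0 ltxx.
  have := mp i (negbT (gt_eqF h)); rewrite gtr0_norm //; lra.
have IHp : k * (\sum_i deg_in u i * `|p' i|) <= variation u b p'.
  apply: IH => [|P' N' P'p N'p]; last first.
    by apply: kP => i; [move/P'p/p'_gt | move/N'p/p'_lt].
  apply: leq_trans pc; apply: proper_card; apply/properP; split.
    apply/subsetP => i; rewrite !inE /p'; apply: contraNneq => ->.
    by rewrite sgr0 mulr0 subr0.
  exists i1; rewrite !inE // negbK subr_eq0.
  by rewrite {1}[p i1]numEsg mulrC.
have -> : variation u b p = variation u b p' + m * variation u b (level R P N).
  rewrite /variation [m * _]mulrCA -mulrDr; congr (_ * _).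
  rewrite mulr_sumr -big_split; apply: eq_bigr => i _.
  rewrite mulr_sumr -big_split; apply: eq_bigr => j _ /=.
  by rewrite mulrCA -mulrDr -!sgE (abs_sub_layer b m0 (mp i) (mp j)).
have -> : \sum_i deg_in u i * `|p i| =
    \sum_i deg_in u i * `|p' i| + m * (vol u P + vol u N).
  rewrite -(vol_level _ dPN) mulr_sumr -big_split; apply: eq_bigr => i _ /=.
  rewrite mulrCA -mulrDr -sgE; congr (_ * _).
  have := @abs_sub_layer _ false m (p i) 0 m0 (mp i).
  by rewrite eqxx sgr0 !mulr0 subrr mulr0 !addr0; apply.
rewrite mulrDr [k * (m * _)]mulrCA lerD // ler_wpM2l //.
by apply: kP => i; rewrite inE.
Qed.

(** From an isoperimetric constant to a spectral gap: the co-area inequality is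
    applied to the signed squares f * `|f|, whose variation is bounded through
    Cauchy-Schwarz by the energy and its complement. Treating both signs of f
    at once yields the Cheeger bound for b = true and the dual Cheeger bound
    for b = false. *)
Lemma cheeger_energy (R : realType) (n : nat) (u : 'M[R]_n) (b : bool) (k : R)
    (f : 'I_n -> R) :
    (forall i j, 0 <= u i j) -> (forall i j, u i j = u j i) -> 0 <= k ->
    (forall P N : {set 'I_n}, (forall i, i \in P -> 0 < f i) ->
       (forall i, i \in N -> f i < 0) ->
       k * (vol u P + vol u N) <= variation u b (level R P N)) ->
  (1 - Num.sqrt (1 - k ^+ 2)) * sqnorm u f <= energy u b f.
Proof.
move=> u0 usym k0 kP.
have d0 i : 0 <= deg_in u i by apply: sumr_ge0.
pose p i := f i * `|f i|.
have /coarea kp : forall P N : {set 'I_n}, (forall i, i \in P -> 0 < p i) ->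
    (forall i, i \in N -> p i < 0) ->
    k * (vol u P + vol u N) <= variation u b (level R P N).
  have sgp i : Num.sg (p i) = Num.sg (f i).
    rewrite sgrM sgr_norm; have [->|f0] := eqVneq (f i) 0.
      by rewrite sgr0 mul0r.
    by rewrite mulr1.
  move=> P N pP pN; apply: kP => i.
    by move/pP; rewrite -sgr_gt0 sgp sgr_gt0.
  by move/pN; rewrite -sgr_lt0 sgp sgr_lt0.
have pE i : `|p i| = f i ^+ 2.
  by rewrite normrM normr_id -expr2 real_normK ?num_real.
have {pE}kp : k * sqnorm u f <= variation u b p.
  by apply: le_trans kp; rewrite /sqnorm; under [in leRHS]eq_bigr do rewrite pE.
pose q i j := sval (signed_square_split b (f i) (f j)).
have qP i j : [/\ 0 <= q i j, q i j <= (f i + (-1) ^+ b * f j) ^+ 2,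
    q i j <= 2 * (f i ^+ 2 + f j ^+ 2) &
    (p i + (-1) ^+ b * p j) ^+ 2 = q i j * (2 * (f i ^+ 2 + f j ^+ 2) - q i j)].
  by rewrite /q; case: signed_square_split.
pose Q := 2^-1 * \sum_i \sum_j u i j * q i j.
have N0 : 0 <= sqnorm u f.
  by apply: sumr_ge0 => i _; rewrite mulr_ge0 ?sqr_ge0.
apply: (@le_trans _ _ Q); last first.
  rewrite ler_wpM2l ?invr_ge0 //; apply: ler_sum => i _; apply: ler_sum => j _.
  by rewrite ler_wpM2l //; case: (qP i j).
apply: gap_le_of_sqr_le => //.
have QE : 2 * sqnorm u f - Q =
    2^-1 * \sum_i \sum_j u i j * (2 * (f i ^+ 2 + f j ^+ 2) - q i j).
  rewrite /sqnorm -handshake // /Q [2 * _]mulrCA -mulrBr; congr (_ * _).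
  rewrite mulr_sumr -sumrB; apply: eq_bigr => i _.
  rewrite mulr_sumr -sumrB; apply: eq_bigr => j _.
  by rewrite mulrBr mulrCA.
rewrite QE /Q -exprMn; apply: (@le_trans _ _ (variation u b p ^+ 2)).
  by rewrite ler_sqr ?nnegrE ?(le_trans _ kp) ?mulr_ge0.
rewrite /variation exprMn [leRHS]mulrACA -(expr2 2^-1).
rewrite ler_wpM2l ?sqr_ge0 // !pair_bigA /=.
apply: discrete_CauchySchwarz => -[i j] /=.
- by rewrite mulr_ge0 //; case: (qP i j).
- by rewrite mulr_ge0 // subr_ge0; case: (qP i j).
- rewrite exprMn real_normK ?num_real //; case: (qP i j) => _ _ _ ->.
  by rewrite [u i j ^+ 2]expr2 mulrACA.
Qed.

(** * Cuts and Cheeger constants *)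

(** An edge between P and N is cut by both sets, and has variation 2. *)
Lemma variation_level_sub (R : realType) (n : nat) (u : 'M[R]_n)
    (P N : {set 'I_n}) :
    (forall i j, u i j = u j i) -> [disjoint P & N] ->
  variation u true (level R P N) = cut u P (~: P) + cut u N (~: N).
Proof.
move=> usym dPN.
have n11 : `|1 + 1 : R| = 1 + 1 by rewrite ger0_norm // addr_ge0.
have cutE (W : {set 'I_n}) : cut u W (~: W) =
    2^-1 * \sum_i \sum_j u i j * `|(i \in W)%:R - (j \in W)%:R|.
  pose g i j := u i j * ((i \in W) && (j \notin W))%:R.
  have gE : cut u W (~: W) = \sum_i \sum_j g i j.
    rewrite /cut big_mkcond; apply: eq_bigr => i _; rewrite /g.
    case: (i \in W); last by rewrite big1 // => j _; rewrite mulr0.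
    rewrite big_mkcond; apply: eq_bigr => j _; rewrite inE /=.
    by case: (j \in W); rewrite ?mulr0 ?mulr1.
  have gE' : cut u W (~: W) = \sum_i \sum_j g j i by rewrite gE exchange_big.
  have -> : \sum_i \sum_j u i j * `|(i \in W)%:R - (j \in W)%:R| =
      \sum_i \sum_j g i j + \sum_i \sum_j g j i.
    rewrite -big_split; apply: eq_bigr => i _; rewrite -big_split.
    apply: eq_bigr => j _ /=; rewrite /g [u j i]usym.
    by case: (i \in W); case: (j \in W);
      rewrite /= ?(subrr, subr0, sub0r, normrN, normr0, normr1, mulr0, mulr1,
        addr0, add0r).
  by rewrite -gE -gE'; lra.
rewrite !cutE -mulrDr /variation; congr (_ * _).
rewrite -big_split; apply: eq_bigr => i _; rewrite -big_split.
apply: eq_bigr => j _ /=; rewrite -mulrDr; congr (_ * _).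
rewrite expr1 mulN1r /level.
have := (disjointFr dPN (x := i), disjointFr dPN (x := j)) => -[].
case: (i \in P) => [/(_ isT) ->|_]; last case: (i \in N);
  (case: (j \in P) => [/(_ isT) ->|_]; last case: (j \in N));
  rewrite /= ?(subrr, addNr, subr0, sub0r, opprK, oppr0, normrN, normr0,
    normr1, addr0, add0r) //;
  by rewrite -?opprD ?normrN ?n11; lra.
Qed.

(** The edges between P and N are exactly those on which the level function
    cancels out. *)
Lemma variation_level_add (R : realType) (n : nat) (u : 'M[R]_n)
    (P N : {set 'I_n}) :
    (forall i j, u i j = u j i) -> [disjoint P & N] ->
  variation u false (level R P N) = vol u P + vol u N - 2 * cut u P N.
Proof.
move=> usym dPN.
have n11 : `|1 + 1 : R| = 1 + 1 by rewrite ger0_norm // addr_ge0.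
pose g i j := u i j * ((i \in P) && (j \in N))%:R.
have gE : cut u P N = \sum_i \sum_j g i j.
  rewrite /cut big_mkcond; apply: eq_bigr => i _; rewrite /g.
  case: (i \in P); last by rewrite big1 // => j _; rewrite mulr0.
  rewrite big_mkcond; apply: eq_bigr => j _ /=.
  by case: (j \in N); rewrite ?mulr0 ?mulr1.
have gE' : cut u P N = \sum_i \sum_j g j i by rewrite gE exchange_big.
have -> : variation u false (level R P N) =
    2^-1 * (\sum_i \sum_j u i j * (`|level R P N i| + `|level R P N j|)
      - 2 * (\sum_i \sum_j g i j + \sum_i \sum_j g j i)).
  rewrite /variation; congr (_ * _).
  rewrite -big_split mulr_sumr -sumrB; apply: eq_bigr => i _.
  rewrite /= -big_split mulr_sumr -sumrB; apply: eq_bigr => j _.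
  rewrite /= /g [u j i]usym -mulrDr mulrCA -mulrBr; congr (_ * _).
  rewrite expr0 mul1r /level.
  have := (disjointFr dPN (x := i), disjointFr dPN (x := j)) => -[].
  case: (i \in P) => [/(_ isT) ->|_]; last case: (i \in N);
  (case: (j \in P) => [/(_ isT) ->|_]; last case: (j \in N));
  rewrite /= ?(subrr, addNr, subr0, sub0r, opprK, oppr0, normrN, normr0,
    normr1, addr0, add0r, mulr0) //;
  by rewrite -?opprD ?normrN ?n11; lra.
rewrite mulrBr handshake // vol_level // -gE -gE'.
by lra.
Qed.

Lemma cut_ge0 (R : realType) (n : nat) (u : 'M[R]_n) (V W : {set 'I_n}) :
  (forall i j, 0 <= u i j) -> 0 <= cut u V W.
Proof. by move=> u0; apply: sumr_ge0 => i _; apply: sumr_ge0. Qed.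

Lemma vol_gt0 (R : realType) (n : nat) (u : 'M[R]_n) (W : {set 'I_n}) :
  (forall i, 0 < deg_in u i) -> W != set0 -> 0 < vol u W.
Proof.
move=> d0 /set0Pn[i iW]; rewrite /vol (bigD1 i) //=.
by rewrite ltr_wpDr // sumr_ge0 // => j _; apply: ltW.
Qed.

Lemma vol_set0 (R : realType) (n : nat) (u : 'M[R]_n) : vol u set0 = 0.
Proof. exact: big_set0. Qed.

Lemma le_vol (R : realType) (n : nat) (u : 'M[R]_n) (V W : {set 'I_n}) :
  (forall i, 0 <= deg_in u i) -> V \subset W -> vol u V <= vol u W.
Proof.
move=> d0 VW; rewrite /vol [leRHS](big_setID V) /= (setIidPr VW) lerDl.
exact: sumr_ge0.
Qed.

Lemma cheeger_range_nonempty (R : realType) (n : nat) (u : 'M[R]_n) :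
  (2 <= n)%N ->
  [seq cut u W (~: W) / Num.min (vol u W) (vol u (~: W))
     | W in [set W : {set 'I_n} | (W != set0) && (~: W != set0)]] != [::].
Proof.
case: n u => [|[|n]] // u _.
rewrite -size_eq0 size_map -cardE cards_eq0.
apply/set0Pn; exists [set ord0]; rewrite inE; apply/andP; split.
  by apply/set0Pn; exists ord0; rewrite inE.
by apply/set0Pn; exists ord_max; rewrite !inE.
Qed.

Lemma dual_cheeger_range_nonempty (R : realType) (n : nat) (u : 'M[R]_n) :
  (2 <= n)%N ->
  [seq 2 * cut u P.1 P.2 / (vol u P.1 + vol u P.2)
          | P in [set P : {set 'I_n} * {set 'I_n} |
                   [&& P.1 != set0, P.2 != set0 & [disjoint P.1 & P.2]]]]
    != [::].
Proof.
case: n u => [|[|n]] // u _.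
rewrite -size_eq0 size_map -cardE cards_eq0.
apply/set0Pn; exists ([set ord0], [set ord_max]); rewrite inE.
apply/and3P; split.
- by apply/set0Pn; exists ord0; rewrite inE.
- by apply/set0Pn; exists ord_max; rewrite !inE.
- by rewrite disjoints1 inE.
Qed.

Lemma cheeger_ge0 (R : realType) (n : nat) (u : 'M[R]_n) : (2 <= n)%N ->
  (forall i j, 0 <= u i j) -> 0 <= cheeger u.
Proof.
move=> n2 u0; rewrite /cheeger.
have [/imageP[W _ ->] _] := min_seqP (cheeger_range_nonempty u n2).
have v0 V : 0 <= vol u V by apply: sumr_ge0 => i _; apply: sumr_ge0.
by rewrite divr_ge0 ?cut_ge0 // le_min !v0.
Qed.

Lemma cheeger_le (R : realType) (n : nat) (u : 'M[R]_n) (W : {set 'I_n}) :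
    (2 <= n)%N -> (forall i j, 0 <= u i j) -> (forall i, 0 < deg_in u i) ->
    vol u W <= vol u (~: W) ->
  cheeger u * vol u W <= cut u W (~: W).
Proof.
move=> n2 u0 d0 Wle; have [->|Wn0] := eqVneq W set0.
  by rewrite vol_set0 mulr0 cut_ge0.
have Wv := vol_gt0 d0 Wn0.
have WCn0 : ~: W != set0.
  by apply: contraTneq Wle => ->; rewrite vol_set0 -ltNge.
rewrite -ler_pdivlMr // -[in leRHS](min_idPl Wle).
have [_ ] := min_seqP (cheeger_range_nonempty u n2); apply.
by apply/imageP; exists W => //; rewrite inE Wn0.
Qed.

Lemma dual_cheeger_ge (R : realType) (n : nat) (u : 'M[R]_n)
    (P N : {set 'I_n}) :
    (2 <= n)%N -> (forall i j, 0 <= u i j) -> (forall i, 0 < deg_in u i) ->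
    [disjoint P & N] ->
  2 * cut u P N <= dual_cheeger u * (vol u P + vol u N).
Proof.
move=> n2 u0 d0 dPN.
have [im ub] := max_seqP (dual_cheeger_range_nonempty u n2).
have v0 V : 0 <= vol u V by apply: sumr_ge0 => i _; apply: ltW.
have hb0 : 0 <= dual_cheeger u.
  rewrite /dual_cheeger; have /imageP[V _ ->] := im.
  by rewrite divr_ge0 ?mulr_ge0 ?addr_ge0 ?cut_ge0.
have [P0|Pn0] := eqVneq P set0.
  by rewrite /cut P0 big_set0 mulr0 mulr_ge0 ?addr_ge0.
have [N0|Nn0] := eqVneq N set0.
  rewrite /cut N0 big1 ?mulr0 ?mulr_ge0 ?addr_ge0 // => i _.
  by rewrite big_set0.
rewrite -ler_pdivrMr ?addr_gt0 ?vol_gt0 //; apply: ub.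
by apply/imageP; exists (P, N) => //; rewrite inE /= Pn0 Nn0.
Qed.

Lemma dual_cheeger_le1 (R : realType) (n : nat) (u : 'M[R]_n) :
    (2 <= n)%N -> (forall i j, 0 <= u i j) -> (forall i j, u i j = u j i) ->
    (forall i, 0 < deg_in u i) ->
  dual_cheeger u <= 1.
Proof.
move=> n2 u0 usym d0; rewrite /dual_cheeger.
have [/imageP[[P N]] + ->] := max_seqP (dual_cheeger_range_nonempty u n2).
rewrite inE /= => /and3P[P0 N0 dPN] _.
rewrite ler_pdivrMr ?addr_gt0 ?vol_gt0 // mul1r -subr_ge0.
rewrite -variation_level_add // mulr_ge0 ?invr_ge0 //.
by apply: sumr_ge0 => i _; apply: sumr_ge0 => j _; rewrite mulr_ge0.
Qed.

(** * Cheeger and dual Cheeger inequalities *)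

Lemma median_exists (R : realType) (n : nat) (u : 'M[R]_n) (f : 'I_n -> R) :
    (0 < n)%N -> (forall i, 0 <= deg_in u i) ->
  exists c, vol u [set i | c < f i] <= vol u (~: [set i | c < f i]) /\
            vol u [set i | f i < c] <= vol u (~: [set i | f i < c]).
Proof.
case: n u f => // n u f _ d0.
pose up i := [set j | f i < f j].
pose ok i := vol u (up i) <= vol u (~: up i).
have [i0 _ i0max] :=
  @Order.TotalTheory.arg_maxP _ _ _ (ord0 : 'I_n.+1) xpredT f isT.
have ok0 : ok i0.
  have up0 : up i0 = set0.
    by apply/setP => j; rewrite !inE ltNge (i0max j isT : f j <= f i0).
  by rewrite /ok up0 vol_set0 sumr_ge0.
(* The least value of f with at most half of the volume strictly above it. *)
have [i1 ok1 i1min] := @Order.TotalTheory.arg_minP _ _ _ i0 ok f ok0.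
exists (f i1); split => //.
set L := [set i | f i < f i1].
have [->|[j0 j0L]] := set_0Vmem L; first by rewrite vol_set0 sumr_ge0.
(* The next lower value of f has more than half of the volume above it. *)
have [j1 j1L j1max] := @Order.TotalTheory.arg_maxP _ _ _ j0 (mem L) f j0L.
have nok : vol u (~: up j1) <= vol u (up j1).
  have /ltW// : vol u (~: up j1) < vol u (up j1).
  rewrite ltNge; apply/negP => /i1min; apply/negP; rewrite -ltNge.
  by have : j1 \in L := j1L; rewrite inE.
have sub : L \subset ~: up j1.
  by apply/subsetP => i iL; rewrite !inE -leNgt; apply: j1max.
apply: le_trans (le_vol d0 sub) _; apply: le_trans nok (le_vol d0 _).
by rewrite -[up j1]setCK setCS.
Qed.

(** After subtracting a median, the positive and the negative part of f are both
    supported on at most half of the volume, which is what the Cheeger constant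
    controls. *)
Lemma cheeger_inequality (R : realType) (n : nat) (u : 'M[R]_n)
    (f : 'I_n -> R) :
    (2 <= n)%N -> (forall i j, 0 <= u i j) -> (forall i j, u i j = u j i) ->
    (forall i, 0 < deg_in u i) -> \sum_i deg_in u i * f i = 0 ->
  (1 - Num.sqrt (1 - cheeger u ^+ 2)) * sqnorm u f <= energy u true f.
Proof.
move=> n2 u0 usym d0 fmean.
have d0' i : 0 <= deg_in u i by apply: ltW.
have [c [cup cdown]] := median_exists f (ltnW n2) d0'.
have half (V W : {set 'I_n}) : V \subset W -> vol u W <= vol u (~: W) ->
    vol u V <= vol u (~: V).
  move=> VW h; apply: le_trans (le_vol d0' VW) _; apply: le_trans h _.
  by apply: le_vol; rewrite ?setCS.
(* The shift by the median keeps the energy; it can only increase the norm,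
   because f has mean zero. *)
pose g i := f i - c.
have -> : energy u true f = energy u true g.
  congr (_ * _); apply: eq_bigr => i _; apply: eq_bigr => j _.
  by rewrite /g expr1; congr (_ * _ ^+ 2); lra.
apply: (@le_trans _ _ ((1 - Num.sqrt (1 - cheeger u ^+ 2)) * sqnorm u g)).
  apply: ler_wpM2l.
    rewrite subr_ge0 -[leRHS]sqrtr1; apply: ler_wsqrtr.
    by rewrite gerBl sqr_ge0.
  have -> : sqnorm u g = sqnorm u f + c ^+ 2 * (\sum_i deg_in u i)
      - 2 * c * (\sum_i deg_in u i * f i).
    rewrite /sqnorm !mulr_sumr -big_split -sumrB; apply: eq_bigr => i _.
    by rewrite /g /=; ring.
  by rewrite fmean mulr0 subr0 lerDl mulr_ge0 ?sqr_ge0 ?sumr_ge0.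
apply: cheeger_energy => // [|P N Pg Ng]; first exact: cheeger_ge0.
rewrite variation_level_sub ?(disjoint_signs Pg Ng) // mulrDr.
rewrite lerD // cheeger_le //.
  by apply: half cup; apply/subsetP => i /Pg; rewrite inE subr_gt0.
by apply: half cdown; apply/subsetP => i /Ng; rewrite inE subr_lt0.
Qed.

Lemma dual_cheeger_inequality (R : realType) (n : nat) (u : 'M[R]_n)
    (f : 'I_n -> R) :
    (2 <= n)%N -> (forall i j, 0 <= u i j) -> (forall i j, u i j = u j i) ->
    (forall i, 0 < deg_in u i) ->
  (1 - Num.sqrt (1 - (1 - dual_cheeger u) ^+ 2)) * sqnorm u f
    <= energy u false f.
Proof.
move=> n2 u0 usym d0; apply: cheeger_energy => // [|P N Pf Nf].
  by rewrite subr_ge0 dual_cheeger_le1.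
have dPN := disjoint_signs Pf Nf.
have := dual_cheeger_ge n2 u0 d0 dPN.
rewrite variation_level_add //; lra.
Qed.

(** * Splitting off a known eigenvector *)

Lemma char_poly_conj (F : fieldType) (n : nat) (S A M : 'M[F]_n) :
  S \in unitmx -> S *m A = M *m S -> char_poly A = char_poly M.
Proof.
move=> Su SA; pose SX := map_mx (@polyC F) S.
have SX0 : \det SX != 0.
  by rewrite det_map_mx polyC_eq0 -unitfE -unitmxE.
apply: (mulfI SX0); rewrite [RHS]mulrC -!det_mulmx; congr (\det _).
rewrite /char_poly_mx mulmxBr mulmxBl -!map_mxM SA; congr (_ - _).
by rewrite scalar_mxC.
Qed.

Lemma row_complete_unitmx (F : fieldType) (m : nat) (e : 'rV[F]_(1 + m)) :
  e != 0 -> exists2 S : 'M[F]_(1 + m), S \in unitmx & usubmx S = e.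
Proof.
move=> e0; exists ((col_ebase e) 0 0 *: row_ebase e).
  rewrite unitmxZ ?row_ebase_unit // unitfE.
  have := col_ebase_unit e; rewrite [col_ebase e]mx11_scalar unitmxE.
  rewrite det_scalar1.
  by rewrite unitfE mxE eqxx.
rewrite -[RHS](mulmx_ebase e) {2}[col_ebase e]mx11_scalar mul_scalar_mx.
rewrite -scalemxAl.
rewrite rank_rV e0 linearZ /=; congr (_ *: _).
rewrite -{1}[row_ebase e]vsubmxK col_mxKu.
rewrite -{2}[row_ebase e]vsubmxK.
by rewrite pid_mx_row mul_row_col mul1mx mul0mx addr0.
Qed.

Lemma char_poly_trmx (R : comNzRingType) (n : nat) (A : 'M[R]_n) :
  char_poly A^T = char_poly A.
Proof.
rewrite /char_poly -[RHS]det_tr; congr (\det _).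
by rewrite /char_poly_mx linearB /= tr_scalar_mx map_trmx.
Qed.

(** Deflation: in a basis that starts with e, the matrix is block triangular
    and q is the characteristic polynomial of its second diagonal block. This
    also covers the case where z = 0 is a multiple eigenvalue. *)
Lemma eigenvector_orthogonal (F : fieldType) (m : nat) (A : 'M[F]_(1 + m))
    (e : 'rV[F]_(1 + m)) (d : 'cV[F]_(1 + m)) (q : {poly F}) (z : F) :
    e *m A = 0 -> A *m d = 0 -> e *m d != 0 ->
    char_poly A = 'X * q -> root q z ->
  exists v : 'rV[F]_(1 + m), [/\ v != 0, v *m A = z *: v & v *m d = 0].
Proof.
move=> eA Ad ed charA qz.
have e0 : e != 0 by apply: contraNneq ed => ->; rewrite mul0mx.
have [S Su Se] := row_complete_unitmx e0.
have [M SA uM] : exists2 M : 'M[F]_(1 + m), S *m A = M *m S & usubmx M = 0.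
  exists (S *m A *m invmx S); first by rewrite mulmxKV.
  by rewrite -!mul_usub_mx Se eA mul0mx.
have charM : char_poly M = 'X * char_poly (drsubmx M).
  rewrite /char_poly; have -> : char_poly_mx M =
      block_mx 'X%:M 0 (dlsubmx (char_poly_mx M)) (char_poly_mx (drsubmx M)).
    rewrite -[LHS]submxK; congr block_mx.
    - rewrite [ulsubmx _]mx11_scalar !mxE lshift0 eqxx.
      have /matrixP/(_ 0 (lshift m 0)) := uM.
      by rewrite !mxE ?lshift0 => ->; rewrite subr0.
    - apply/matrixP => i j; rewrite !mxE eq_lrshift.
      have /matrixP/(_ i (rshift 1 j)) := uM.
      by rewrite !mxE ?lshift0 => ->; rewrite subr0.
    - by apply/matrixP => i j; rewrite !mxE eq_rshift.
  by rewrite det_lblock det_scalar1.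
have qE : q = char_poly (drsubmx M).
  apply: (mulfI (negbT (polyX_eq0 F))); rewrite -charA -charM.
  exact: char_poly_conj SA.
move: qz; rewrite qE -eigenvalue_root_char => /eigenvalueP[u uB u0].
(* v0 is an eigenvector of A up to a multiple k *: e of e; subtracting c *: e
   makes it orthogonal to d and removes that multiple. *)
pose v0 := row_mx 0 u *m S.
have eS : e = row_mx 1%:M 0 *m S.
  by rewrite -[S]vsubmxK mul_row_col Se mul1mx mul0mx addr0.
have v0A : v0 *m A = (u *m dlsubmx M) 0 0 *: e + z *: v0.
  rewrite -mulmxA SA mulmxA.
  have -> : row_mx 0 u *m M = row_mx (u *m dlsubmx M) (z *: u).
    rewrite -{1}[M]vsubmxK mul_row_col mul0mx add0r.
    by rewrite -{1}[dsubmx M]hsubmxK mul_mx_row -uB.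
  rewrite eS !scalemxAl -mulmxDl; congr (_ *m S).
  by rewrite !scale_row_mx add_row_mx !scaler0 addr0 add0r scalemx1
    -mx11_scalar.
move: v0A; set k := (_ 0 0) => v0A.
pose c := (v0 *m d) 0 0 / (e *m d) 0 0.
have ed0 : (e *m d) 0 0 != 0.
  by apply: contraNneq ed => h; rewrite [e *m d]mx11_scalar h raddf0.
have kc : k + z * c = 0.
  apply: (mulIf ed0); rewrite mulrDl -mulrA mulfVK // mul0r.
  have := congr1 (fun N => (N *m d) 0 0) v0A.
  rewrite /= -mulmxA Ad mulmx0 mulmxDl -!scalemxAl mxE [X in _ = X -> _]mxE.
  by rewrite [X in _ = X + _ -> _]mxE [X in _ = _ + X -> _]mxE => <-.
exists (v0 - c *: e); split.
- apply: contraNneq u0 => /eqP; rewrite subr_eq0 /v0 eS scalemxAl.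
  move=> /eqP/(can_inj (mulmxK Su)).
  by rewrite scale_row_mx scaler0 => /eq_row_mx[_ ->].
- rewrite mulmxBl -scalemxAl eA scaler0 subr0 v0A scalerBr scalerA.
  have -> : z * c = - k by apply/eqP; rewrite -addr_eq0 addrC kc.
  by rewrite scaleNr opprK addrC.
- rewrite mulmxBl -scalemxAl [e *m d]mx11_scalar [v0 *m d]mx11_scalar.
  by rewrite scale_scalar_mx mulfVK ?subrr.
Qed.

(** * The Laplacian of a balanced digraph and its underlying graph *)

Lemma deg_in_gt0 (R : realType) (n : nat) (w : 'M[R]_n) :
    (2 <= n)%N -> (forall i j, 0 <= w i j) -> balanced w ->
    weakly_connected w ->
  forall i, 0 < deg_in w i.
Proof.
case: n w => [|[|n]] // w _ w0 wbal wcon i.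
(* A path from i to another vertex begins with an edge at i, possibly a loop. *)
have [j ji] : exists j : 'I_n.+2, j != i.
  have [->|i0] := eqVneq i ord0; first by exists ord_max.
  by exists ord0; rewrite eq_sym.
have /connectP[[|k s] /=] := wcon i j.
  by move=> _ e; rewrite e eqxx in ji.
case/andP => + _ _; rewrite /adjacent /= => /orP[wik|wki].
  rewrite /deg_in (bigD1 k) //= ltr_wpDr ?sumr_ge0 // lt_def wik.
  exact: w0.
rewrite wbal /deg_out (bigD1 k) //= ltr_wpDr ?sumr_ge0 // lt_def wki.
exact: w0.
Qed.

Lemma deg_underlying (R : realType) (n : nat) (w : 'M[R]_n) : balanced w ->
  forall i, deg_in (underlying w) i = 2 * deg_in w i.
Proof.
move=> wbal i; rewrite mulr2n mulrDl mul1r {2}wbal -big_split.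
by apply: eq_bigr => j _; rewrite mxE.
Qed.

Lemma energy_underlying (R : realType) (n : nat) (w : 'M[R]_n)
    (f : 'I_n -> R) : balanced w ->
  energy (underlying w) true f =
    sqnorm (underlying w) f - 2 * \sum_i \sum_j w i j * f i * f j.
Proof.
move=> wbal.
have usym i j : underlying w i j = underlying w j i by rewrite !mxE addrC.
have -> : 2 * \sum_i \sum_j w i j * f i * f j =
    2^-1 * \sum_i \sum_j 2 * (underlying w i j * f i * f j).
  have E : \sum_i \sum_j w j i * f i * f j = \sum_i \sum_j w i j * f i * f j.
    rewrite exchange_big; apply: eq_bigr => i _; apply: eq_bigr => j _.
    by rewrite mulrAC.
  have -> : \sum_i \sum_j 2 * (underlying w i j * f i * f j) =
      2 * \sum_i \sum_j w i j * f i * f j + 2 * \sum_i \sum_j w j i * f i * f j.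
    rewrite !mulr_sumr -big_split; apply: eq_bigr => i _.
    rewrite !mulr_sumr -big_split; apply: eq_bigr => j _.
    by rewrite mxE /=; ring.
  by rewrite E; lra.
rewrite /sqnorm -handshake // -mulrBr; congr (_ * _).
rewrite -sumrB; apply: eq_bigr => i _; rewrite -sumrB; apply: eq_bigr => j _.
by rewrite expr1; ring.
Qed.

Lemma Re_sum (R : rcfType) (I : finType) (F : I -> R[i]) :
  complex.Re (\sum_i F i) = \sum_i complex.Re (F i).
Proof. by apply: (big_morph (@complex.Re R)) => // -[a b] [c d]. Qed.

Lemma Im_sum (R : rcfType) (I : finType) (F : I -> R[i]) :
  complex.Im (\sum_i F i) = \sum_i complex.Im (F i).
Proof. by apply: (big_morph (@complex.Im R)) => // -[a b] [c d]. Qed.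

(** The antisymmetric part of w only contributes to the imaginary part of the
    quotient, and symmetrizing w keeps the degrees because w is balanced. *)
Lemma rayleigh_quotient (R : realType) (n : nat) (w : 'M[R]_n)
    (z : R[i]) (v : 'cV[R[i]]_n) :
    balanced w -> (forall i, 0 < deg_in w i) -> laplacian w v = z *: v ->
  let a i := complex.Re (v i 0) in let b i := complex.Im (v i 0) in
  energy (underlying w) true a + energy (underlying w) true b =
  complex.Re z * (sqnorm (underlying w) a + sqnorm (underlying w) b).
Proof.
move=> wbal d0 vz a b; rewrite !energy_underlying //.
have ReC r t : complex.Re (r%:C * t) = r * complex.Re t.
  by case: t => x y /=; rewrite mul0r subr0.
have ImC r t : complex.Im (r%:C * t) = r * complex.Im t.
  by case: t => x y /=; rewrite mul0r addr0.
have eqn i : deg_in w i * (a i ^+ 2 + b i ^+ 2) -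
    \sum_j (w i j * a i * a j + w i j * b i * b j) =
    complex.Re z * (deg_in w i * (a i ^+ 2 + b i ^+ 2)).
  have := congr1 (fun u : 'cV[R[i]]_n => u i 0) vz; rewrite /= !mxE gt_eqF //=.
  move=> /(congr1 (fun t => (deg_in w i)%:C * t)).
  have dK t : (deg_in w i)%:C * ((deg_in w i)^-1%:C * t) = t.
    by rewrite mulrA -rmorphM /= divff ?gt_eqF // mul1r.
  rewrite mulrBr dK => vzi.
  have reE : deg_in w i * a i - \sum_j w i j * a j =
      deg_in w i * (complex.Re z * a i - complex.Im z * b i).
    move: (congr1 (@complex.Re R) vzi); rewrite raddfB /= Re_sum !ReC.
    rewrite (eq_bigr (fun j => w i j * a j)) => [->|j _]; last exact: ReC.
    congr (_ * _); by rewrite /a /b; case: z (v i 0) {vz vzi} => [x y] [].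
  have imE : deg_in w i * b i - \sum_j w i j * b j =
      deg_in w i * (complex.Re z * b i + complex.Im z * a i).
    move: (congr1 (@complex.Im R) vzi); rewrite raddfB /= Im_sum !ImC.
    rewrite (eq_bigr (fun j => w i j * b j)) => [->|j _]; last exact: ImC.
    congr (_ * _); by rewrite /a /b; case: z (v i 0) {vz vzi reE} => [x y] [].
  have -> : \sum_j (w i j * a i * a j + w i j * b i * b j) =
      a i * (\sum_j w i j * a j) + b i * (\sum_j w i j * b j).
    rewrite !mulr_sumr -big_split; apply: eq_bigr => j _ /=; ring.
  transitivity (a i * (deg_in w i * a i - \sum_j w i j * a j)
    + b i * (deg_in w i * b i - \sum_j w i j * b j)); first by ring.
  by rewrite reE imE; ring.
have NE : sqnorm (underlying w) a + sqnorm (underlying w) b =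
    2 * \sum_i deg_in w i * (a i ^+ 2 + b i ^+ 2).
  rewrite -big_split mulr_sumr; apply: eq_bigr => i _.
  by rewrite deg_underlying //=; ring.
have CE : \sum_i \sum_j w i j * a i * a j + \sum_i \sum_j w i j * b i * b j =
    \sum_i \sum_j (w i j * a i * a j + w i j * b i * b j).
  by rewrite -big_split; apply: eq_bigr => i _; rewrite -big_split.
have : \sum_i (deg_in w i * (a i ^+ 2 + b i ^+ 2) -
    \sum_j (w i j * a i * a j + w i j * b i * b j)) =
    complex.Re z * \sum_i (deg_in w i * (a i ^+ 2 + b i ^+ 2)).
  by rewrite mulr_sumr; apply: eq_bigr => i _; apply: eqn.
rewrite NE sumrB -CE; lra.
Qed.

Lemma deg_laplacian (R : realType) (n : nat) (w : 'M[R]_n) (v : 'cV[R[i]]_n) :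
    balanced w -> (forall i, 0 < deg_in w i) ->
  \sum_i (deg_in w i)%:C * laplacian w v i 0 = 0.
Proof.
move=> wbal d0.
have -> : \sum_i (deg_in w i)%:C * laplacian w v i 0 =
    \sum_i ((deg_in w i)%:C * v i 0 - \sum_j (w i j)%:C * v j 0).
  apply: eq_bigr => i _; rewrite mxE gt_eqF //= mulrBr; congr (_ - _).
  by rewrite mulrA -rmorphM /= divff ?gt_eqF // mul1r.
rewrite sumrB [X in _ - X]exchange_big -sumrB big1 // => i _.
by rewrite -mulr_suml -rmorph_sum /= -/(deg_out w i) -wbal subrr.
Qed.

(** By balance the degree vector is a left null vector of the Laplacian, while
    the constants are right null vectors; hence every eigenvalue beyond the one
    of the constants has an eigenvector of mean zero. *)
Lemma laplacian_eigenvector (R : realType) (n : nat) (w : 'M[R]_n) (z : R[i]) :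
    balanced w -> (forall i, 0 < deg_in w i) ->
    z \in nonzero_index_eigenvalues w ->
  exists v : 'cV[R[i]]_n, [/\ v != 0, laplacian w v = z *: v &
    \sum_i (deg_in w i)%:C * v i 0 = 0].
Proof.
case: n w => [|m] w wbal d0.
  have /size0nil := size_eigenvalues (laplacian_mx w).
  by rewrite /nonzero_index_eigenvalues => ->.
move=> zw.
pose A : 'M[R[i]]_(1 + m) := (laplacian_mx w)^T.
pose e : 'rV[R[i]]_(1 + m) := const_mx 1.
pose d : 'cV[R[i]]_(1 + m) := \col_i (deg_in w i)%:C.
have eA : e *m A = 0.
  apply: trmx_inj; rewrite trmx_mul trmxK trmx_const trmx0.
  by rewrite laplacian_mxE laplacian_const.
have Ad : A *m d = 0.
  apply/colP => j; rewrite !mxE -[RHS](deg_laplacian (delta_mx j 0) wbal d0).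
  by apply: eq_bigr => i _; rewrite !mxE mulrC.
have ed : e *m d != 0.
  apply/eqP => /matrixP/(_ 0 0)/eqP; rewrite !mxE.
  under eq_bigr do rewrite !mxE mul1r.
  rewrite -rmorph_sum /= fmorph_eq0 gt_eqF //.
  by rewrite (bigD1 ord0) //= ltr_wpDr // sumr_ge0 // => i _; apply: ltW.
have charA : char_poly A =
    'X * \prod_(t <- nonzero_index_eigenvalues w) ('X - t%:P).
  rewrite char_poly_trmx eigenvaluesP.
  rewrite (perm_big _ (perm_to_rem (eigenvalues_laplacian0 w isT))) big_cons.
  by rewrite subr0.
have qz : root (\prod_(t <- nonzero_index_eigenvalues w) ('X - t%:P)) z.
  by rewrite root_prod_XsubC.
have [v [v0 vA vd]] := eigenvector_orthogonal eA Ad ed charA qz.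
exists v^T; split.
- by rewrite trmx_eq0.
- rewrite -laplacian_mxE; apply: trmx_inj.
  by rewrite trmx_mul trmxK vA linearZ /= trmxK.
- have /matrixP/(_ 0 0) := vd; rewrite !mxE => vd0.
  by rewrite -[RHS]vd0; apply: eq_bigr => i _; rewrite !mxE mulrC.
Qed.

(** The upper bound comes from the signless energy, which complements the
    Dirichlet energy to twice the norm. *)
Lemma nonzero_index_bounds (R : realType) (n : nat) (w : 'M[R]_n) (z : R[i]) :
    (2 <= n)%N -> (forall i j, 0 <= w i j) -> balanced w ->
    weakly_connected w -> z \in nonzero_index_eigenvalues w ->
  1 - Num.sqrt (1 - cheeger (underlying w) ^+ 2) <= complex.Re z /\
  complex.Re z <= 1 + Num.sqrt (1 - (1 - dual_cheeger (underlying w)) ^+ 2).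
Proof.
move=> n2 w0 wbal wcon zw; set u := underlying w.
have d0 := deg_in_gt0 n2 w0 wbal wcon.
have u0 i j : 0 <= u i j by rewrite mxE addr_ge0.
have usym i j : u i j = u j i by rewrite !mxE addrC.
have du0 i : 0 < deg_in u i by rewrite deg_underlying // mulr_gt0.
have [v [v0 vz vmean]] := laplacian_eigenvector wbal d0 zw.
have /= := rayleigh_quotient wbal d0 vz; rewrite -/u.
set a := fun i => complex.Re _; set b := fun i => complex.Im _ => rayleigh.
have am : \sum_i deg_in u i * a i = 0.
  have := congr1 (@complex.Re R) vmean; rewrite Re_sum /= => am.
  rewrite -[RHS](mulr0 2) -[in RHS]am mulr_sumr; apply: eq_bigr => i _.
  rewrite deg_underlying // /a -mulrA; congr (_ * _).
  by case: (v i 0) => x y /=; rewrite mul0r subr0.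
have bm : \sum_i deg_in u i * b i = 0.
  have := congr1 (@complex.Im R) vmean; rewrite Im_sum /= => bm.
  rewrite -[RHS](mulr0 2) -[in RHS]bm mulr_sumr; apply: eq_bigr => i _.
  rewrite deg_underlying // /b -mulrA; congr (_ * _).
  by case: (v i 0) => x y /=; rewrite mul0r addr0.
have N0 : 0 < sqnorm u a + sqnorm u b.
  have [i vi] : exists i, v i 0 != 0.
    apply/existsP; apply: contraNT v0; rewrite negb_exists => /forallP v0.
    by apply/eqP/colP => i; rewrite mxE; apply/eqP/negbNE.
  rewrite -big_split (bigD1 i) //= ltr_wpDr //.
    by apply: sumr_ge0 => j _; rewrite addr_ge0 // mulr_ge0 ?sqr_ge0 // ltW.
  rewrite -mulrDr mulr_gt0 // lt_def addr_ge0 ?sqr_ge0 // andbT.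
  apply: contraNneq vi; rewrite /a /b; case: (v i 0) => x y /=.
  move/eqP; rewrite paddr_eq0 ?sqr_ge0 // !sqrf_eq0 => /andP[/eqP-> /eqP->].
  by [].
split; rewrite -(ler_pM2r N0) -rayleigh.
  by rewrite mulrDr lerD // cheeger_inequality.
have := dual_cheeger_inequality a n2 u0 usym du0.
have := dual_cheeger_inequality b n2 u0 usym du0.
have := energy_complement a usym; have := energy_complement b usym.
by lra.
Qed.

Theorem theorem8p2 (R : realType) (n : nat) (w : 'M[R]_n)
    (n_ge2 : (2 <= n)%N)
    (w_ge0 : forall i j, 0 <= w i j)
    (w_balanced : balanced w)
    (w_connected : weakly_connected w) :
  let h := cheeger (underlying w) in
  let hbar := dual_cheeger (underlying w) in
  (0 <= 1 - Num.sqrt (1 - h ^+ 2) /\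
   1 - Num.sqrt (1 - h ^+ 2)
     <= min_seq [seq complex.Re z | z <- nonzero_index_eigenvalues w]) /\
  (max_seq [seq complex.Re z | z <- eigenvalues (laplacian_mx w)]
     <= 1 + Num.sqrt (1 - (1 - hbar) ^+ 2) /\
   1 + Num.sqrt (1 - (1 - hbar) ^+ 2) <= 2).
Proof.
move=> h hbar.
have sqrt_le1 x : Num.sqrt (1 - x ^+ 2) <= 1 :> R.
  by rewrite -[leRHS]sqrtr1 ler_wsqrtr // gerBl sqr_ge0.
have bounds z :=
  @nonzero_index_bounds R n w z n_ge2 w_ge0 w_balanced w_connected.
have zero_ev := eigenvalues_laplacian0 w (ltnW n_ge2).
split; split.
- by rewrite subr_ge0.
- have ne : [seq complex.Re z | z <- nonzero_index_eigenvalues w] != [::].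
    rewrite -size_eq0 size_map size_rem // size_eigenvalues.
    case: n n_ge2 {w w_ge0 w_balanced w_connected h hbar bounds zero_ev}
      => [|n] //.
    by case: n.
  by have [/mapP[z /bounds[lo _] ->] _] := min_seqP ne.
- have ne : [seq complex.Re z | z <- eigenvalues (laplacian_mx w)] != [::].
    by rewrite -size_eq0 size_map size_eigenvalues -lt0n ltnW.
  have [/mapP[z + ->] _] := max_seqP ne.
  rewrite (perm_mem (perm_to_rem zero_ev)) inE => /predU1P[->|/bounds[]//].
  by rewrite addr_ge0 ?sqrtr_ge0.
- by rewrite -[leRHS]/(1 + 1) lerD2l.
Qed.
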